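(* Let $K$ be a Jacobson ring. Then every integral Jacobson radical $K$-algebra is nil. That is: if $R$ is a $K$-algebra such that every element of $R$ is integral over $K$ and every element of $R$ is quasi-regular (i.e. $R=J(R)$), then every element of $R$ is nilpotent.
   Context: Algebras are associative, possibly nonunital and noncommutative. A Jacobson ring (Hilbert ring) is a commutative unital ring $K$ in which every prime ideal is an intersection of maximal ideals. Let $R$ be a $K$-algebra. An element $a\in R$ is integral over $K$ if there is a monic polynomial $p\in K[x]$ with $p(0)=0$ and $p(a)=0$; $R$ is integral over $K$ if all its elements are. Quasi-multiplication on $R$ is $a\circ b=a+b-ab$; $(R,\circ)$ is a monoid with identity $0$. An element $a\in R$ is quasi-regular if there is $a'\in R$ with $a\circ a'=a'\circ a=0$. The Jacobson radical $J(R)$ is the largest ideal of $R$ consisting of quasi-regular elements; $R$ is Jacobson radical if $R=J(R)$. $R$ is nil if every element of $R$ is nilpotent. *)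

(* Defs.v *)
From HB Require Import structures.
From mathcomp Require Import all_boot all_order all_algebra.
From mathcomp Require Import mathcomp_extra boolp classical_sets.

Set Implicit Arguments.
Unset Strict Implicit.
Unset Printing Implicit Defensive.

Import GRing.Theory.
Local Open Scope ring_scope.

(* A possibly nonunital, noncommutative associative K-algebra: associativity
   comes from Semigroup, whose product is written (x * y)%g; addition and
   scaling are those of Lmodule, in ring_scope. *)
HB.mixin Record Semigroup_Lmodule_isNuAlgebra (K : comNzRingType) R
    of Semigroup R & GRing.Lmodule K R := {
  nu_mulDl : forall x y z : R, ((x + y)%R * z)%g = (x * z)%g + (y * z)%g;
  nu_mulDr : forall x y z : R, (x * (y + z)%R)%g = (x * y)%g + (x * z)%g;
  nu_scaleAl : forall (k : K) (x y : R), k *: (x * y)%g = ((k *: x)%R * y)%g;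
  nu_scaleAr : forall (k : K) (x y : R), k *: (x * y)%g = (x * (k *: y)%R)%g
}.

#[short(type="nuAlgType")]
HB.structure Definition NuAlgebra (K : comNzRingType) :=
  {R of Semigroup R & GRing.Lmodule K R & Semigroup_Lmodule_isNuAlgebra K R}.

Section JacobsonRing.
Variable K : comNzRingType.
Local Open Scope classical_set_scope.

(* idealr_closed contains 1 \notin I: it describes proper ideals. *)
Definition is_prime_ideal (P : set K) : Prop :=
  idealr_closed (mem P) /\ prime_idealr_closed (mem P).

Definition is_maximal_ideal (M : set K) : Prop :=
  idealr_closed (mem M) /\
  forall I : set K, idealr_closed (mem I) -> M `<=` I -> I = M.

Definition jacobson_ring : Prop :=
  forall P : set K, is_prime_ideal P ->
    exists2 F : set (set K),
      F `<=` is_maximal_ideal & P = \bigcap_(M in F) M.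

End JacobsonRing.

Section NuAlgebraDefs.
Variables (K : comNzRingType) (R : nuAlgType K).
Implicit Types (a b x y : R) (I : set R).
Local Open Scope classical_set_scope.

(* a ^ n for n > 0; there is no unit, and the value 0 at n = 0 is junk that is
   never used below. *)
Definition nu_exp a (n : nat) : R := iterop n (fun x y => (x * y)%g) a 0.

(* p(a) for p with zero constant term. *)
Definition nu_eval (p : {poly K}) a : R :=
  \sum_(1 <= i < size p) p`_i *: nu_exp a i.

Definition integral_elt a : Prop :=
  exists p : {poly K}, [/\ p \is monic, p.[0] = 0 & nu_eval p a = 0].

Definition integral_alg : Prop := forall a, integral_elt a.

Definition quasi_mul a b : R := a + b - (a * b)%g.

Definition quasi_regular a : Prop :=
  exists a', quasi_mul a a' = 0 /\ quasi_mul a' a = 0.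

Definition nu_ideal I : Prop :=
  [/\ I 0,
      forall x y, I x -> I y -> I (x + y),
      forall (k : K) x, I x -> I (k *: x)
    & forall a x, I x -> I (a * x)%g /\ I (x * a)%g].

Definition quasi_regular_ideal I : Prop :=
  nu_ideal I /\ I `<=` quasi_regular.

Definition is_jacobson_radical (J : set R) : Prop :=
  quasi_regular_ideal J /\ forall I, quasi_regular_ideal I -> I `<=` J.

Definition jacobson_radical_alg : Prop := is_jacobson_radical [set: R].

Definition nilpotent_elt a : Prop := exists2 n, (0 < n)%N & nu_exp a n = 0.

Definition nil_alg : Prop := forall a, nilpotent_elt a.

End NuAlgebraDefs.

Arguments jacobson_ring : clear implicits.
Arguments integral_alg {K} R.
Arguments jacobson_radical_alg {K} R.
Arguments nil_alg {K} R.

(* Main.v *)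
(** Work in the unitization K x R and let I be the kernel of K[X] -> K x R,
    X |-> (0, a). If a is not nilpotent, some prime Q of K[X] contains I but
    not X. Dividing powers of X out of a monic element of Q gives c = - X h
    modulo Q with c outside P, the contraction of Q to K; pick a maximal M
    containing P but not c, and write k c = 1 - m with m in M. Then
    w = 1 + k X h is congruent to m modulo Q, while w(a) has an inverse that is
    integral over K. Reversing the monic equation of that inverse gives s with
    s(0) = 1 and s(w) in I, so s(m) lies in P, hence in M; as m is in M too,
    so is 1. *)
Require Import Defs.
From HB Require Import structures.
From mathcomp Require Import all_boot all_order all_algebra.
From mathcomp Require Import mathcomp_extra boolp classical_sets.
From mathcomp Require Import ring.

Set Implicit Arguments.
Unset Strict Implicit.
Unset Printing Implicit Defensive.

Import GRing.Theory.
Local Open Scope ring_scope.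
Local Open Scope classical_set_scope.

(** * Ideals and primes of a commutative ring *)

Section Ideals.
Variable A : comNzRingType.
Implicit Types (I M Q : set A) (a u v x y : A).

(* Unlike idealr_closed, this allows the unit ideal. *)
Definition ideal_set I := I 0 /\ forall a u v, I u -> I v -> I (a * u + v).

Lemma idealr_closed_setP I :
  idealr_closed (mem I) <-> ideal_set I /\ ~ I 1.
Proof.
split=> [[/set_mem I0 nI1 IM]|[[I0 IM] nI1]].
  split; last by move=> I1; case/negP: nI1; apply/mem_set.
  by split=> // a u v Iu Iv; apply/set_mem/IM; apply/mem_set.
split; [exact/mem_set | by apply/negP => /set_mem |].
by move=> a u v /set_mem Iu /set_mem Iv; apply/mem_set/IM.
Qed.

Lemma prime_idealr_closed_setP I :
  prime_idealr_closed (mem I) <-> forall u v, I (u * v) -> I u \/ I v.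
Proof.
split=> [Ipr u v Iuv|Ipr u v /set_mem /Ipr [] /mem_set ->]; rewrite ?orbT//.
have /orP[] := Ipr u v (mem_set Iuv); last by right; apply/set_mem.
by left; apply/set_mem.
Qed.

Lemma ideal_setMl I a u : ideal_set I -> I u -> I (a * u).
Proof. by move=> [I0 IM] Iu; rewrite -[_ * _]addr0; apply: IM. Qed.

Lemma ideal_setD I u v : ideal_set I -> I u -> I v -> I (u + v).
Proof. by move=> [_ IM] Iu Iv; rewrite -[u]mul1r; apply: IM. Qed.

Lemma ideal_setB I u v : ideal_set I -> I u -> I v -> I (u - v).
Proof. by move=> [_ IM] Iu Iv; rewrite addrC -mulN1r; apply: IM. Qed.

Definition ideal_adjoin I x : set A := [set z | exists a, I (z - a * x)].

Lemma ideal_adjoinP I x : ideal_set I ->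
  [/\ ideal_set (ideal_adjoin I x), I `<=` ideal_adjoin I x
    & ideal_adjoin I x x].
Proof.
move=> [I0 IM]; split; first split.
- by exists 0; rewrite mul0r subr0.
- move=> a u v [b Ib] [c Ic]; exists (a * b + c).
  have -> : a * u + v - (a * b + c) * x = a * (u - b * x) + (v - c * x) by ring.
  exact: IM.
- by move=> z Iz; exists 0; rewrite mul0r subr0.
- by exists 1; rewrite mul1r subrr.
Qed.

(** An ideal maximal among those containing [I] and missing all powers of [x] is prime: adjoining
    any element outside it brings in a power of [x]. *)
Lemma exists_prime_ideal_avoiding I x : ideal_set I ->
  (forall n, ~ I (x ^+ n)) ->
  exists Q, [/\ is_prime_ideal Q, I `<=` Q & ~ Q x].
Proof.
move=> Iid Ix.
(* Writing the ideals as I `|` X makes the empty chain harmless. *)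
pose good X := ideal_set (I `|` X) /\ forall n, ~ (I `|` X) (x ^+ n).
have [F Fgood Ftot|X [[Jid Jx] Xmax]] := @Zorn_bigcup A good.
  split; last first.
    by move=> n [/Ix//|[X FX Xx]]; apply: (Fgood _ FX).2; right; exact: Xx.
  split; first by left; case: Iid.
  move=> a u v Ju Jv.
  (* By totality of the chain, both elements lie in one member, unless both come from [I]. *)
  have [Iuv|[X FX [Xu Xv]]] : (I u /\ I v) \/
      exists2 X, F X & (I `|` X) u /\ (I `|` X) v.
  - case: Ju Jv => [Iu|[X FX Xu]] [Iv|[Y FY Yv]]; [by left| | |]; right.
    + by exists Y => //; split; [left|right].
    + by exists X => //; split; [right|left].
    + have [XY|YX] := Ftot _ _ FX FY.
        by exists Y => //; split; right=> //; apply: XY.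
      by exists X => //; split; right=> //; apply: YX.
  - by left; apply: Iid.2; case: Iuv.
  - case: ((Fgood _ FX).1.2 a _ _ Xu Xv) => [?|?]; first by left.
    by right; exists X.
set J := I `|` X in Jid Jx.
have IJ : I `<=` J by move=> z; left.
have power u : ~ J u -> exists n, ideal_adjoin J u (x ^+ n).
  move=> nJu; apply: contrapT => nJux.
  have [uid Ju uu] := ideal_adjoinP u Jid.
  have IuE : I `|` ideal_adjoin J u = ideal_adjoin J u.
    by apply/seteqP; split=> z; [case=> // /IJ/Ju|right].
  apply: (Xmax (ideal_adjoin J u)); last first.
    by split; rewrite IuE// => n Jn; apply: nJux; exists n.
  split=> [z Xz|XE]; first by apply: Ju; right.
  by apply: nJu; right; apply: XE.
exists J; split=> //; last by rewrite -[x]expr1.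
split; first by apply/idealr_closed_setP; split=> //; rewrite -(expr0 x).
apply/prime_idealr_closed_setP => u v Juv.
have [Ju|/power[n [a Ja]]] := pselect (J u); first by left.
have [Jv|/power[m [b Jb]]] := pselect (J v); first by right.
exfalso; apply: (Jx (n + m)%N).
(* Modulo [J], [x ^+ n] may be replaced by [a * u] and [x ^+ m] by [b * v], leaving a multiple of
   [u * v]. *)
have -> : x ^+ (n + m) = x ^+ m * (x ^+ n - a * u)
    + (a * u * (x ^+ m - b * v) + a * b * (u * v)) by rewrite exprD; ring.
by do 2?apply: ideal_setD => //; apply: ideal_setMl.
Qed.

Lemma maximal_ideal_inverse M x : is_maximal_ideal M -> ~ M x ->
  exists k, M (1 - k * x).
Proof.
move=> [/idealr_closed_setP[Mid nM1] Mmax] nMx.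
have [xid Mx xx] := ideal_adjoinP x Mid.
have [[k Mk]|n1] := pselect (ideal_adjoin M x 1); first by exists k.
case: nMx; rewrite -(Mmax (ideal_adjoin M x))//.
exact/idealr_closed_setP.
Qed.

(** Used for congruences: the values of [p] agree modulo any ideal containing [x - y]. *)
Lemma dvd_horner_sub (p : {poly A}) x y :
  exists z, p.[x] - p.[y] = z * (x - y).
Proof.
elim/poly_ind: p => [|p c [z IHp]]; first by exists 0; rewrite !horner0; ring.
exists (p.[x] + z * y); rewrite !hornerE.
have -> : p.[x] * x + c - (p.[y] * y + c) =
  p.[x] * (x - y) + (p.[x] - p.[y]) * y by ring.
by rewrite IHp; ring.
Qed.

End Ideals.

(** * Primes of K[X] and the Jacobson property of K *)

Section JacobsonPoly.
Variable K : comNzRingType.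
Implicit Types (p q r s h : {poly K}) (I Q : set {poly K}).

Lemma poly_divX p : exists h, p = h * 'X + p.[0]%:P.
Proof.
elim/poly_ind: p => [|p c _]; first by exists 0; rewrite horner0 mul0r addr0.
by exists p; rewrite hornerMXaddC mulr0 add0r.
Qed.

Lemma prime_contraction Q : is_prime_ideal Q -> is_prime_ideal (polyC @^-1` Q).
Proof.
move=> [/idealr_closed_setP[[Q0 QM] nQ1] /prime_idealr_closed_setP Qpr].
split; last by apply/prime_idealr_closed_setP => u v /=; rewrite polyCM => /Qpr.
apply/idealr_closed_setP; split=> //; split=> // a u v /= Qu Qv.
by rewrite polyCD polyCM; apply: QM.
Qed.

(** Descent on the degree: when the constant term of [p] is in [Q], so is [h * 'X], and primality
    passes to the monic quotient [h]. *)
Lemma prime_avoidX_const Q p : is_prime_ideal Q -> ~ Q 'X ->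
  p \is monic -> Q p -> exists2 r, Q r & ~ Q r.[0]%:P.
Proof.
move=> [/idealr_closed_setP[Qid nQ1] /prime_idealr_closed_setP Qpr] nQX.
have [n] := ubnP (size p); elim: n p => // n IHn p ltpn pmon Qp.
have [Qc|] := pselect (Q p.[0]%:P); last by exists p.
have [h ph] := poly_divX p.
(* A constant monic [p] would be 1, which is not in the proper ideal [Q]. *)
have [h0|hn0] := eqVneq h 0.
  case: nQ1; move: pmon Qp; rewrite ph h0 mul0r add0r.
  by rewrite monicE lead_coefC => /eqP->.
have szp : size p = (size h).+1.
  rewrite ph size_polyDl size_mulX// size_polyC ltnS.
  by rewrite (leq_trans (leq_b1 _))// size_poly_gt0.
have QhX : Q (h * 'X) by rewrite -[h * 'X](addrK p.[0]%:P) -ph; exact: ideal_setB.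
apply: (IHn h); first by rewrite -ltnS -szp.
  (* The top index of [p] is [size h], which is positive, so [p.[0]] does not contribute to the
     leading coefficient. *)
  move: pmon; rewrite !monicE /lead_coef szp /= [in X in X -> _]ph.
  rewrite coefD coefMX coefC.
  by move: hn0; rewrite -size_poly_gt0; case: (size h) => //= m _; rewrite addr0.
by case: (Qpr _ _ QhX).
Qed.

(** A relation s(w) = 0 modulo [I] with s(0) = 1 says that w is invertible there with inverse
    integral over [K]; quasi-regularity and integrality will supply it for [1 - h * 'X]. *)
Lemma jacobson_poly_nil I p : jacobson_ring K -> ideal_set I ->
  p \is monic -> I p ->
  (forall h, exists2 s, s.[0] = 1 & I (s \Po (1 - h * 'X))) ->
  exists n, I 'X^n.
Proof.
move=> Kjac Iid pmon Ip Iinv; apply: contrapT => /forallNP InX.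
have [Q [Qpr IQ nQX]] := exists_prime_ideal_avoiding Iid InX.
have [/idealr_closed_setP[Qid _] _] := Qpr.
have [r Qr nQr] := prime_avoidX_const Qpr nQX pmon (IQ _ Ip).
have [F Fmax PF] := Kjac _ (prime_contraction Qpr).
have [M FM nMr] : exists2 M, F M & ~ M r.[0].
  apply: contrapT => nM; apply: nQr; have: (polyC @^-1` Q) r.[0]; last by [].
  by rewrite PF => M FM; apply: contrapT => nMr; apply: nM; exists M.
have PM : polyC @^-1` Q `<=` M by rewrite PF; apply: bigcap_inf.
have [k Mk] := maximal_ideal_inverse (Fmax _ FM) nMr.
have [/idealr_closed_setP[Mid nM1] _] := Fmax _ FM.
set m := 1 - k * r.[0] in Mk.
have [h rh] := poly_divX r.
(* This choice gives w = 1 + k h X, so that w - m = k r lies in [Q]. *)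
have [s s0 Is] := Iinv (- k%:P * h).
set w := 1 - _ in Is.
(* With coefficients lifted to K[X], both [s \Po w] and the constant s(m) are values of one
   polynomial. *)
have [z zE] := dvd_horner_sub s^:P w m%:P.
have Msm : M s.[m].
  apply: PM => /=; rewrite -horner_map/=.
  have -> : s^:P.[m%:P] = s \Po w - (s^:P.[w] - s^:P.[m%:P]).
    by rewrite /comp_poly; ring.
  apply: ideal_setB => //; first exact: IQ.
  rewrite zE; apply: ideal_setMl => //.
  have -> : w - m%:P = k%:P * r.
    rewrite /w /m polyCB polyCM [in RHS]rh; ring.
  exact: ideal_setMl.
(* Since s(0) = 1, s(m) is 1 plus a multiple of [m]. *)
have [y] := dvd_horner_sub s m 0; rewrite s0 subr0 => yE.
apply: nM1; rewrite -[1](subKr s.[m]) yE.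
by apply: ideal_setB => //; apply: ideal_setMl.
Qed.

End JacobsonPoly.

(** * Evaluation in a unital algebra and integral inverses *)

Section IntegralInverse.
Variables (K : comNzRingType) (U : algType K).
Implicit Types (a v w : U) (p q s : {poly K}).

Lemma horner_algZ a k p : horner_alg a (k *: p) = k *: horner_alg a p.
Proof. by rewrite -mul_polyC rmorphM/= horner_algC mulr_algl. Qed.

Lemma horner_algE a p : horner_alg a p = \sum_(i < size p) p`_i *: a ^+ i.
Proof.
rewrite -{1}[p]coefK poly_def rmorph_sum/=; apply: eq_bigr => i _.
by rewrite horner_algZ rmorphXn/= horner_algX.
Qed.

Lemma horner_alg_comp a p q :
  horner_alg a (p \Po q) = horner_alg (horner_alg a q) p.
Proof.
rewrite comp_polyE rmorph_sum/= horner_algE; apply: eq_bigr => i _.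
by rewrite horner_algZ rmorphXn.
Qed.

(* The hypotheses say that [1 - y] is the inverse of [w]; the polynomial is
   [w ^ n * q(y)], up to sign, expressed in [w] alone. *)
Lemma integral_quasi_inverse w y q : GRing.comm w y -> w * y = w - 1 ->
  q \is monic -> horner_alg y q = 0 ->
  exists2 s, s.[0] = 1 & horner_alg w s = 0.
Proof.
move=> cwy wy qmon qy; pose n := (size q).-1.
have szq : size q = n.+1 by rewrite prednK// size_poly_gt0 monic_neq0.
exists ((-1) ^+ n *: \sum_(i < n.+1) q`_i *: ('X^(n - i) * ('X - 1) ^+ i)).
  (* At 0 only the term of index [n] survives; its value (-1)^n is cancelled by the sign in
     front. *)
  rewrite hornerZ horner_sum big_ord_recr/= big1 => [|i _].
    rewrite add0r subnn mul1r hornerZ horner_exp hornerD hornerX hornerN hornerC.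
    have -> : q`_n = 1 by exact/monicP.
    by rewrite mul1r add0r -exprMn mulrNN mulr1 expr1n.
  by rewrite hornerZ hornerM hornerXn expr0n subn_eq0 leqNgt ltn_ord mul0r mulr0.
rewrite horner_algZ rmorph_sum.
(* By commutation w^n y^i = w^(n-i) (w y)^i, and w y = w - 1. *)
suff -> : \sum_(i < n.+1) horner_alg w (q`_i *: ('X^(n - i) * ('X - 1) ^+ i)) =
    w ^+ n * horner_alg y q by rewrite qy mulr0 scaler0.
rewrite [in RHS]horner_algE szq mulr_sumr; apply: eq_bigr => i _.
rewrite horner_algZ rmorphM !rmorphXn rmorphB rmorph1/= horner_algX -wy.
by rewrite exprMn_comm// mulrA -exprD subnK ?leq_ord// scalerAr.
Qed.

End IntegralInverse.

(** * Adjoining a unit to R *)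

Section Unitization.
Variables (K : comNzRingType) (R : nuAlgType K).

(** Pairs (k, a) are read as formal sums k + a; the separate name carries the multiplication
    obtained by expanding such sums. *)
Definition unitization : Type := (K^o * R)%type.
HB.instance Definition _ := GRing.Lmodule.copy unitization (K^o * R)%type.
Implicit Types (x y z : unitization) (a b : R) (p : {poly K}).

Definition unitization_one : unitization := (1, 0).
Definition unitization_mul x y : unitization :=
  (x.1 * y.1, (x.1 : K) *: y.2 + (y.1 : K) *: x.2 + (x.2 * y.2)%g).

Lemma nu_mul0r a : (0 * a)%g = 0 :> R.
Proof. by apply: (addIr (0 * a)%g); rewrite -nu_mulDl !add0r. Qed.

Lemma nu_mulr0 a : (a * 0)%g = 0 :> R.
Proof. by apply: (addIr (a * 0)%g); rewrite -nu_mulDr !add0r. Qed.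

Lemma unitization_eq x y : x.1 = y.1 -> x.2 = y.2 -> x = y.
Proof. by case: x y => [k a] [l b] /= -> ->. Qed.

Fact unitization_mulA : associative unitization_mul.
Proof.
move=> [k a] [l b] [m c]; apply: unitization_eq => /=; first exact: mulrA.
rewrite !nu_mulDl !nu_mulDr !scalerDr !scalerA -!nu_scaleAl -!nu_scaleAr mulgA.
rewrite [(m * k)%R]mulrC [(m * l)%R]mulrC -!addrA; do 2 congr (_ + _).
by rewrite addrCA; congr (_ + _); rewrite [RHS]addrCA; congr (_ + _); rewrite addrCA.
Qed.

Fact unitization_mul1r : left_id unitization_one unitization_mul.
Proof.
move=> [k a]; apply: unitization_eq => /=; first exact: mul1r.
by rewrite scale1r scaler0 nu_mul0r !addr0.
Qed.

Fact unitization_mulr1 : right_id unitization_one unitization_mul.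
Proof.
move=> [k a]; apply: unitization_eq => /=; first exact: mulr1.
by rewrite scale1r scaler0 nu_mulr0 add0r addr0.
Qed.

Fact unitization_mulDl : left_distributive unitization_mul +%R.
Proof.
move=> [k a] [l b] [m c]; apply: unitization_eq => /=; first exact: mulrDl.
by rewrite nu_mulDl scalerDl scalerDr [X in X + _ = _]addrACA [LHS]addrACA.
Qed.

Fact unitization_mulDr : right_distributive unitization_mul +%R.
Proof.
move=> [k a] [l b] [m c]; apply: unitization_eq => /=; first exact: mulrDr.
by rewrite nu_mulDr scalerDl scalerDr [X in X + _ = _]addrACA [LHS]addrACA.
Qed.

Fact unitization_1_neq0 : unitization_one != 0.
Proof. by apply/eqP => -[/eqP]; rewrite oner_eq0. Qed.

HB.instance Definition _ := GRing.Zmodule_isNzRing.Build unitization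
  unitization_mulA unitization_mul1r unitization_mulr1
  unitization_mulDl unitization_mulDr unitization_1_neq0.

Fact unitization_scalerAl (k : K) x y : k *: (x * y) = k *: x * y.
Proof.
move: x y => [l a] [m b]; apply: unitization_eq => /=; first exact: mulrA.
by rewrite !scalerDr !scalerA nu_scaleAl (mulrC k m).
Qed.

HB.instance Definition _ :=
  GRing.Lmodule_isLalgebra.Build K unitization unitization_scalerAl.

Fact unitization_scalerAr (k : K) x y : k *: (x * y) = x * (k *: y).
Proof.
move: x y => [l a] [m b]; apply: unitization_eq => /=; first exact: mulrCA.
by rewrite !scalerDr !scalerA nu_scaleAr (mulrC k l).
Qed.

HB.instance Definition _ :=
  GRing.Lalgebra_isAlgebra.Build K unitization unitization_scalerAr.

Definition unitize a : unitization := (0, a).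

Lemma unitizeM a b : unitize a * unitize b = unitize (a * b)%g.
Proof. by apply: unitization_eq => /=; rewrite ?mul0r// !scale0r !add0r. Qed.

Lemma unitizeD a b : unitize (a + b) = unitize a + unitize b.
Proof. by apply: unitization_eq => //=; rewrite [RHS]addr0. Qed.

(** Exponent 0 is excluded: there the power is 1 while [nu_exp] is 0. *)
Lemma unitizeX a n : unitize a ^+ n.+1 = unitize (nu_exp a n.+1).
Proof.
elim: n => [|n IHn]; first by rewrite expr1.
by rewrite exprS IHn unitizeM.
Qed.

(** Links integrality in [R] to evaluation in a unital algebra: when p(0) = 0, [p] kills [a] exactly
    when it kills [unitize a]. *)
Lemma horner_alg_unitize a p :
  horner_alg (unitize a) p = (p.[0], nu_eval p a).
Proof.
rewrite horner_algE horner_coef0 /nu_eval.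
case szp: (size p) => [|n].
  by rewrite big_ord0 big_geq// nth_default ?szp.
rewrite big_ord_recl big_add1 big_mkord expr0 /=.
under eq_bigr do rewrite /bump/= add1n unitizeX.
transitivity (p`_0 *: unitization_one +
  unitize (\sum_(i < n) p`_i.+1 *: nu_exp a i.+1)); last first.
  apply: unitization_eq => /=; first by rewrite [LHS]addr0 [LHS]mulr1.
  by rewrite scaler0 add0r.
congr (_ + _); elim/big_rec2: _ => // i y x _ ->.
by apply: unitization_eq => //=; rewrite [LHS]addr0 [LHS]mulr0.
Qed.

End Unitization.

Theorem theorem3p9 (K : comNzRingType) (R : nuAlgType K) :
  jacobson_ring K -> integral_alg R -> jacobson_radical_alg R -> nil_alg R.
Proof.
move=> Kjac Rint [[_ Rqr] _] a.
pose ev := horner_alg (unitize a).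
have evid : ideal_set [set p | ev p = 0].
  split=> [|p u v /= evu evv]; first exact: rmorph0.
  by rewrite /ev rmorphD rmorphM/= -/ev evu evv mulr0 addr0.
have [p [pmon p0 pa]] := Rint a.
have evp : ev p = 0 by rewrite /ev horner_alg_unitize p0 pa.
have [h|[|n] evX] := jacobson_poly_nil Kjac evid pmon evp.
- pose b := nu_eval (h * 'X) a.
  have evh : ev (1 - h * 'X) = 1 - unitize b.
    by rewrite /ev rmorphB rmorph1/= horner_alg_unitize hornerM hornerX mulr0.
  (* In the unitization these relations make 1 - b' the two-sided inverse of 1 - b. *)
  have [b' [bb' b'b]] := Rqr b I.
  have [q [qmon q0 qb']] := Rint b'.
  have bM : (b * b')%g = b + b' by apply/esym/eqP; rewrite -subr_eq0; apply/eqP.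
  have b'M : (b' * b)%g = b + b'.
    by rewrite addrC; apply/esym/eqP; rewrite -subr_eq0; apply/eqP.
  have cb : GRing.comm (1 - unitize b) (unitize b').
    apply: commr_sym; apply: commrB; first exact: commr1.
    by rewrite /GRing.comm !unitizeM bM b'M.
  have wb : (1 - unitize b) * unitize b' = 1 - unitize b - 1.
    rewrite mulrBl mul1r unitizeM bM unitizeD opprD addrCA subrr addr0.
    by rewrite addrC addKr.
  have [s s0 sw] : exists2 s, s.[0] = 1 & horner_alg (1 - unitize b) s = 0.
    apply: (integral_quasi_inverse cb wb qmon).
    by rewrite horner_alg_unitize q0 qb'.
  by exists s => //=; rewrite /ev horner_alg_comp -/ev evh.
(* Exponent 0 would give 1 = 0 in the unitization. *)
- by move: evX; rewrite /= /ev expr0 rmorph1 => /eqP; rewrite oner_eq0.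
- move: evX; rewrite /= /ev rmorphXn/= horner_algX unitizeX => -[aX].
  by exists n.+1.
Qed.
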